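(* Let $\kappa$ be a regular uncountable cardinal and $\lambda>\kappa$ a cardinal. Suppose that $\alpha$ is an ordinal with $3\le\alpha\le\kappa$ and $H$ is an ideal on $P_\kappa(\lambda)$ such that $\mathrm{cof}(H)<\mathbf{non}_\kappa(J^+\to(J^+,\alpha)^2)$. Then $H^+\xrightarrow[\kappa]{\kappa}(H^+;\alpha)^2$.
   Context: For a cardinal $\mu$ and a set $A$, $P_\mu(A)=\{a\subseteq A:|a|<\mu\}$. An ideal on an infinite set $S$ is a collection $K$ of subsets of $S$ containing all singletons, closed under subsets and finite unions, with $S\notin K$; $K^+=P(S)\setminus K$; $\mathrm{cof}(K)$ is the least cardinality of an $X\subseteq K$ with $K=\bigcup_{A\in X}P(A)$. $K$ is $\kappa$-complete if it is closed under unions of fewer than $\kappa$ members. ''Ideal on $\kappa$'' always means $\kappa$-complete ideal on $\kappa$. $I_{\kappa,\lambda}$ is the set of all $A\subseteq P_\kappa(\lambda)$ such that $A\cap\{b\in P_\kappa(\lambda):a\subseteq b\}=\emptyset$ for some $a\in P_\kappa(\lambda)$. ''Ideal on $P_\kappa(\lambda)$'' always means a $\kappa$-complete ideal $H$ on $P_\kappa(\lambda)$ that is fine ($I_{\kappa,\lambda}\subseteq H$). For $A\subseteq\kappa$, $[A]^2=\{(\xi,\eta)\in A\times A:\xi<\eta\}$. For an ideal $J$ on $\kappa$, $J^+\to(J^+,\alpha)^2$ means: for every $A\in J^+$ and every $f:[A]^2\to2$ there is $B\subseteq A$ such that either $B\in J^+$ and $f$ is identically $0$ on $[B]^2$, or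 $B$ has order type $\alpha$ and $f$ is identically $1$ on $[B]^2$. $\mathbf{non}_\kappa(J^+\to(J^+,\alpha)^2)$ is the least cardinal $\tau$ such that there is an ideal $J$ on $\kappa$ with $\mathrm{cof}(J)=\tau$ for which $J^+\to(J^+,\alpha)^2$ fails. For $A\subseteq P_\kappa(\lambda)$, $[A]^2_{\kappa,\kappa}=\{(\bigcup(a\cap\kappa),\bigcup(b\cap\kappa)):a,b\in A,\ \bigcup(a\cap\kappa)<\bigcup(b\cap\kappa)\}$. $H^+\xrightarrow[\kappa]{\kappa}(H^+;\alpha)^2$ means: for every $F:[P_\kappa(\lambda)]^2_{\kappa,\kappa}\to2$ and every $A\in H^+$ there is $B\subseteq A$ such that either $B\in H^+$ and $F$ is identically $0$ on $[B]^2_{\kappa,\kappa}$, or $\{\bigcup(a\cap\kappa):a\in B\}$ has order type $\alpha$ and $F$ is identically $1$ on $[B]^2_{\kappa,\kappa}$. *)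

(* Defs.v *)
From HB Require Import structures.
From mathcomp Require Import all_boot all_order.
From mathcomp Require Import boolp classical_sets functions cardinality.

Set Implicit Arguments.
Unset Strict Implicit.
Unset Printing Implicit Defensive.

Local Open Scope classical_set_scope.
Local Open Scope card_scope.
Local Open Scope order_scope.

(* The ordinal lambda is a well-ordered type L, whose elements stand for the
   ordinals below lambda: x : L, as a von Neumann ordinal, is the set
   [seg x] of its predecessors.  Ordinals below lambda, in particular kappa
   and every alpha <= kappa, are therefore elements of L. *)

Definition well_ordered d (L : orderType d) : Prop :=
  well_founded (fun x y : L => x < y).

Definition seg d (L : orderType d) (x : L) : set L := [set y | y < x].

Definition card_lt T U (A : set T) (B : set U) : Prop :=
  A #<= B /\ ~ (B #<= A).

Definition whole_is_cardinal d (L : orderType d) : Prop :=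
  forall x : L, card_lt (seg x) [set: L].

Definition is_cardinal d (L : orderType d) (x : L) : Prop :=
  forall y, y < x -> card_lt (seg y) (seg x).

(* cf(x) = x, for x an infinite cardinal. *)
Definition is_regular d (L : orderType d) (x : L) : Prop :=
  [/\ is_cardinal x, infinite_set (seg x) &
      forall A : set L, A `<=` seg x ->
        (forall y, y < x -> exists2 z, A z & y <= z) -> seg x #<= A].

Definition order_type d (L : orderType d) (B : set L) (alpha : L) : Prop :=
  exists g : L -> L, set_bij B (seg alpha) g /\
    (forall x y, B x -> B y -> x < y -> g x < g y).

(* 3 <= alpha, as ordinals. *)
Definition at_least_three d (L : orderType d) (alpha : L) : Prop :=
  exists x y z : L, [/\ x < y, y < z & z < alpha].

Record is_ideal T (S : set T) (K : set (set T)) : Prop := IsIdeal {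
  ideal_infinite : infinite_set S;
  ideal_on : forall A, K A -> A `<=` S;
  ideal_set1 : forall x, S x -> K [set x];
  ideal_sub : forall A B, K B -> A `<=` B -> K A;
  ideal_setU : forall A B, K A -> K B -> K (A `|` B);
  ideal_proper : ~ K S }.

Definition positive T (S : set T) (K : set (set T)) : set (set T) :=
  [set A | A `<=` S /\ ~ K A].

Definition complete d (L : orderType d) (kappa : L) T (K : set (set T)) : Prop :=
  forall X : set (set T), X `<=` K -> card_lt X (seg kappa) ->
    K (\bigcup_(A in X) A).

Definition generates T (K X : set (set T)) : Prop :=
  X `<=` K /\ K = \bigcup_(A in X) [set B | B `<=` A].

(* Cardinal numbers are represented by sets of that cardinality:
   [is_cof K D] means cof(K) = |D|. *)
Definition is_cof T U (K : set (set T)) (D : set U) : Prop :=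
  (exists2 X, generates K X & D #= X) /\
  (forall X, generates K X -> D #<= X).

Section Kappa.
Context (d : Order.disp_t) (L : orderType d).
Implicit Types (kappa alpha : L).

Definition ideal_on_kappa kappa (J : set (set L)) : Prop :=
  is_ideal (seg kappa) J /\ complete kappa J.

Definition pairs (A : set L) : set (L * L) :=
  [set p | [/\ A p.1, A p.2 & p.1 < p.2]].

(* In both partition relations a colouring is a total function on L * L, of
   which only the values on the relevant set of pairs are used; the colours
   0 and 1 are false and true. *)
Definition constant_on (D : set (L * L)) (f : L * L -> bool) (c : bool) : Prop :=
  forall p, D p -> f p = c.

(* J^+ -> (J^+, alpha)^2 *)
Definition arrow kappa (J : set (set L)) alpha : Prop :=
  forall (A : set L) (f : L * L -> bool), positive (seg kappa) J A ->
    exists2 B : set L, B `<=` A &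
      (positive (seg kappa) J B /\ constant_on (pairs B) f false) \/
      (order_type B alpha /\ constant_on (pairs B) f true).

(* non_kappa(J^+ -> (J^+, alpha)^2) = |N|.  Every cof(J), for J an ideal on
   kappa, is the cardinality of a family of subsets of kappa, so M need only
   range over set (set L). *)
Definition is_non kappa alpha U (N : set U) : Prop :=
  (exists J, [/\ ideal_on_kappa kappa J, is_cof J N & ~ arrow kappa J alpha]) /\
  (forall J (M : set (set L)),
     ideal_on_kappa kappa J -> is_cof J M -> ~ arrow kappa J alpha -> N #<= M).

Definition Pk kappa : set (set L) := [set a | card_lt a (seg kappa)].

Definition Ikl kappa : set (set (set L)) :=
  [set A | A `<=` Pk kappa /\
     exists2 a, Pk kappa a & A `&` [set b | Pk kappa b /\ a `<=` b] = set0].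

Definition ideal_on_Pk kappa (H : set (set (set L))) : Prop :=
  [/\ is_ideal (Pk kappa) H, complete kappa H & Ikl kappa `<=` H].

(* The ordinal \bigcup (a \cap kappa).  For kappa regular and a in
   P_kappa(lambda) this union of ordinals is an ordinal below kappa, so the
   default value of xget is not used. *)
Definition cupk kappa (a : set L) : L :=
  xget kappa [set s | seg s = \bigcup_(x in a `&` seg kappa) seg x].

Definition pairs_kk kappa (A : set (set L)) : set (L * L) :=
  [set p | exists a b, [/\ A a, A b, cupk kappa a < cupk kappa b &
                          p = (cupk kappa a, cupk kappa b)]].

(* H^+ -> (H^+; alpha)^2 with kappa, kappa over and under the arrow *)
Definition arrow_kk kappa (H : set (set (set L))) alpha : Prop :=
  forall (F : L * L -> bool) (A : set (set L)), positive (Pk kappa) H A ->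
    exists2 B : set (set L), B `<=` A &
      (positive (Pk kappa) H B /\ constant_on (pairs_kk kappa B) F false) \/
      (order_type (cupk kappa @` B) alpha /\
       constant_on (pairs_kk kappa B) F true).

End Kappa.

(* Main.v *)
(* Given A in H^+, push the restriction of H to A forward along
   a |-> \bigcup (a \cap kappa): the sets Y of ordinals below kappa whose
   preimage meets A in a member of H form an ideal J on kappa.  If X
   generates H, then the sets of those x whose fiber in A is included in B,
   for B in X, generate J, so cof(J) <= cof(H) and J^+ -> (J^+, alpha)^2.
   Apply this relation to the image of A, and pull the homogeneous set back
   to A. *)
Require Import Defs.
From mathcomp Require Import all_boot all_order.
From mathcomp Require Import boolp classical_sets functions cardinality.
Set Implicit Arguments.
Unset Strict Implicit.
Unset Printing Implicit Defensive.
Import Order.TTheory.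
Local Open Scope classical_set_scope.
Local Open Scope card_scope.
Local Open Scope order_scope.

Lemma exists_card_min T (F : set (set T)) : F !=set0 ->
  exists2 X, F X & forall Y, F Y -> X #<= Y.
Proof.
(* A maximal set of choice functions that pairwise differ everywhere must
   exhaust some member of F, which then injects into every other member. *)
move=> [X0 FX0].
pose P (S : set (set T -> T)) := forall X, F X ->
  (forall g, S g -> X (g X)) /\ (forall g h, S g -> S h -> g X = h X -> g = h).
have [|S [PS maxS]] := @Zorn_bigcup _ P.
  move=> C CP totC X FX; split=> [g [S CS Sg]|g h [S CS Sg] [S' CS' S'h]].
    exact: (CP S CS X FX).1.
  have [SS'|S'S] := totC _ _ CS CS'.
    by apply: (CP S' CS' X FX).2 => //; apply: SS'.
  by apply: (CP S CS X FX).2 => //; apply: S'S.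
have [X FX sub] : exists2 X, F X & X `<=` (fun g => g X) @` S.
  apply: contrapT => nsub.
  have /choice[h hP] : forall X, exists x,
      F X -> X x /\ ~ ((fun g => g X) @` S) x.
    move=> X; have [FX|nFX] := pselect (F X); last first.
      (* Outside [F] any value of [h] will do, and [X0] supplies one: an empty [X0] would be covered
         by [S]. *)
      have [X0e|/set0P[x _]] := eqVneq X0 set0; last by exists x.
      by case: nsub; exists X0; rewrite // X0e.
    apply: contrapT => no; apply: nsub; exists X => // x Xx.
    by apply: contrapT => nx; apply: no; exists x.
  apply: (maxS (S `|` [set h])).
    split; first by move=> g; left.
    by move=> /(_ h (or_intror erefl)) Sh; apply: (hP _ FX0).2; exists h.
  move=> X FX; split=> [g [Sg|->]|g g' [Sg|->] [Sg'|->]] //.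
  - exact: (PS X FX).1.
  - exact: (hP X FX).1.
  - exact: (PS X FX).2.
  - by move=> e; case: (hP X FX).2; exists g.
  - by move=> e; case: (hP X FX).2; exists g'.
exists X => // Y FY.
(* Evaluation at [X] covers [X] by [S], and evaluation at [Y] embeds [S] in [Y]. *)
apply: (card_le_trans (subset_card_le sub)).
apply: (card_le_trans (card_image_le _ _)).
have imS : (fun g => g Y) @` S #= S.
  by apply: inj_card_eq => g h /set_mem Sg /set_mem Sh; apply: (PS Y FY).2.
rewrite -(card_le_eql imS).
by apply: subset_card_le => _ [g Sg <-]; apply: (PS Y FY).1.
Qed.

Lemma card_lt_le_trans T U V (A : set T) (B : set U) (C : set V) :
  A #<= B -> card_lt B C -> card_lt A C.
Proof.
move=> AB [BC nCB]; split; first exact: card_le_trans AB BC.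
by move=> CA; apply: nCB; apply: card_le_trans CA AB.
Qed.

Section Regular.
Context (d : Order.disp_t) (L : orderType d).
Hypotheses (L_wo : well_ordered L) (kappa : L) (kappa_reg : is_regular kappa).

Lemma exists_least (P : set L) : P !=set0 ->
  exists2 x, P x & forall y, y < x -> ~ P y.
Proof.
move=> [x]; elim/(well_founded_ind L_wo): x => x IH Px.
have [[y /andP[yx /asboolP Py]]|no] := pselect (exists y, (y < x) && `[< P y >]).
  exact: (IH y).
exists x => // y yx Py; apply: no; exists y; rewrite yx; exact/asboolP.
Qed.

(** Otherwise the singleton of [x] would be cofinal in [kappa], and regularity would make
    [seg kappa] finite. *)
Lemma regular_gt x : x < kappa -> exists2 y, x < y & y < kappa.
Proof.
case: kappa_reg => _ kinf kreg xk; apply: contrapT => no; apply: kinf.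
apply: (@card_le_finite _ _ _ [set x]) => //.
apply: kreg => [_ ->//|y yk]; exists x => //.
by rewrite leNgt; apply/negP => xy; apply: no; exists y.
Qed.

Lemma Pk_set1 x : Pk kappa [set x].
Proof.
case: kappa_reg => _ kinf _; split; last first.
  by move=> k1; apply: kinf; apply: (card_le_finite k1).
have /set0P[y ky] : seg kappa != set0.
  by apply/eqP => k0; apply: kinf; rewrite k0.
rewrite (card_le_eql (card_eq_trans card_set1 (card_esym (@card_set1 _ y)))).
by apply: subset_card_le => _ ->.
Qed.

(** By regularity, the part of [a] below [kappa] is too small to be cofinal, so the union omits some
    ordinal below [kappa]. Being downward closed, the union is the segment of the least ordinal that
    it omits. *)
Lemma seg_cupk a : Pk kappa a ->
  seg (cupk kappa a) = \bigcup_(x in a `&` seg kappa) seg x.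
Proof.
move=> [_ nka]; set U := \bigcup_(_ in _) _.
apply: (@xgetPex _ kappa [set s | seg s = U]).
have [y yk nUy] : exists2 y, y < kappa & ~ U y.
  apply: contrapT => no; apply: nka.
  apply: card_le_trans (subset_card_le (@subIsetl _ a (seg kappa))).
  case: kappa_reg => _ _; apply=> [x []//|y yk].
  apply: contrapT => no'; apply: no; exists y => // -[z az yz].
  by apply: no'; exists z => //; apply: ltW.
have [s nUs min] : exists2 s, (~` U) s & forall y, y < s -> ~ (~` U) y.
  by apply: exists_least; exists y.
exists s; apply/seteqP; split=> x; first by move=> xs; apply: contrapT => nUx; apply: (min x xs nUx).
move=> [z az xz]; rewrite /seg /= ltNge; apply/negP => sx.
by apply: nUs; exists z => //; apply: le_lt_trans sx xz.
Qed.

Lemma cupk_lt a : Pk kappa a -> cupk kappa a < kappa.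
Proof.
(* If the union reached [kappa], then [a] would be cofinal in [kappa], hence too large. *)
move=> Pa; rewrite ltNge; apply/negP => kc.
case: (Pa) => _; apply; case: kappa_reg => _ _ kreg.
apply: card_le_trans (subset_card_le (@subIsetl _ a (seg kappa))).
apply: kreg => [x []//|y yk].
have : seg (cupk kappa a) y by apply: lt_le_trans yk kc.
by rewrite seg_cupk// => -[z az yz]; exists z => //; apply: ltW.
Qed.

Lemma lt_cupk a x y : Pk kappa a -> x < y -> y < kappa -> a y ->
  x < cupk kappa a.
Proof.
move=> Pa xy yk ay; suff : seg (cupk kappa a) x by [].
by rewrite seg_cupk//; exists y.
Qed.

Definition fiber (A : set (set L)) (Y : set L) : set (set L) :=
  A `&` cupk kappa @^-1` Y.

Section Projection.
Context (H : set (set (set L))) (A : set (set L)).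
Hypotheses (H_ideal : ideal_on_Pk kappa H) (A_pos : positive (Pk kappa) H A).

Definition projected_ideal : set (set L) :=
  [set Y | Y `<=` seg kappa /\ H (fiber A Y)].

Lemma projected_ideal_on_kappa : ideal_on_kappa kappa projected_ideal.
Proof.
case: H_ideal A_pos => -[_ _ _ Hsub HU _] Hcompl HI [APk nHA].
split; first split.
- by case: kappa_reg.
- by move=> Y [].
- move=> x xk; split; first by move=> _ ->.
  (* Fineness of [H] enters here: any [a] containing some [y] above [x] is sent strictly above [x],
     so the fiber over [x] misses the cone of the singleton of [y]. *)
  have [y xy yk] := regular_gt xk.
  apply: HI; split; first by move=> a [/APk].
  exists [set y]; first exact: Pk_set1.
  rewrite -subset0 => a [[_ ax] [Pa ya]].
  by have := lt_cupk Pa xy yk (ya y erefl); rewrite ax ltxx.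
- move=> Y Z [Zk HZ] YZ; split; first exact: subset_trans YZ Zk.
  by apply: Hsub HZ _ => a [Aa /YZ].
- move=> Y Z [Yk HY] [Zk HZ]; split; first by rewrite subUset.
  by rewrite /fiber preimage_setU setIUr; apply: HU.
- move=> [_ HA]; apply: nHA; apply: Hsub HA _ => a Aa; split=> //.
  exact/cupk_lt/APk.
move=> X XJ Xk; split; first by move=> x [Y /XJ[Yk _] /Yk].
(* The fiber over a union is the union of the fibers, of which there are at most as many as members
   of [X]. *)
rewrite /fiber preimage_bigcup setI_bigcupr -(bigcup_image X (fiber A) id).
apply: Hcompl; first by move=> _ [Y /XJ[_ HY] <-].
exact: card_lt_le_trans (card_image_le _ _) Xk.
Qed.

Lemma projected_ideal_generates X : generates H X ->
  exists2 Y, generates projected_ideal Y & Y #<= X.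
Proof.
case: H_ideal => -[_ _ _ Hsub _ _] _ _ [XH HE].
pose up B := [set x | x < kappa /\ fiber A [set x] `<=` B].
exists (up @` X); last exact: card_image_le.
have upJ B : X B -> projected_ideal (up B).
  move=> XB; split; first by move=> x [].
  apply: Hsub (XH _ XB) _ => a [Aa [_ sub]]; exact: sub.
have JX : up @` X `<=` projected_ideal by move=> _ [B /upJ ? <-].
split=> //; apply/seteqP; split=> Y.
  (* The fiber over [Y] lies in [H], hence inside some [B] in [X]; so does the fiber over each point
     of [Y], which puts [Y] inside [up B]. *)
  move=> [Yk]; rewrite {1}HE => -[B XB sub].
  exists (up B); first by exists B.
  move=> x Yx; split; first exact: Yk.
  by move=> a [Aa ax]; apply: sub; split=> //; rewrite /preimage/= ax.
move=> [Z /JX JZ YZ]; case: projected_ideal_on_kappa => -[_ _ _ Jsub _ _] _.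
exact: Jsub JZ YZ.
Qed.

End Projection.

Lemma arrow_kk_of_arrow H alpha : ideal_on_Pk kappa H ->
  (forall A, positive (Pk kappa) H A ->
     arrow kappa (projected_ideal H A) alpha) ->
  arrow_kk kappa H alpha.
Proof.
move=> H_ideal arr F A A_pos; have [APk nHA] := A_pos.
have [[_ _ _ Hsub _ _] _ _] := H_ideal.
(* The fiber over the image of [A] is all of [A], which is not in [H]. *)
have Apos : positive (seg kappa) (projected_ideal H A) (cupk kappa @` A).
  split; first by move=> _ [a /APk Pa <-]; apply: cupk_lt.
  by move=> [_ HA]; apply: nHA; apply: Hsub HA _ => a Aa; split=> //; exists a.
have [B BA HB] := arr A A_pos _ F Apos.
pose B' := fiber A B.
have pB c : constant_on (pairs B) F c -> constant_on (pairs_kk kappa B') F c.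
  by move=> cB _ [a [b [[_ Ba] [_ Bb] ab ->]]]; apply: cB.
exists B'; first exact: subIsetl.
case: HB => [[[Bk nJB] /pB cB]|[oB /pB cB]]; [left|right]; split=> //.
  by split=> [a [/APk]|HB'] //; apply: nJB.
(* Every point of [B] is attained on [A], so pulling back and projecting again loses nothing and the
   order type is kept. *)
suff -> : cupk kappa @` B' = B by [].
apply/seteqP; split=> [_ [a [_ Ba] <-]//|x Bx].
by have [a Aa ax] := BA _ Bx; exists a => //; split=> //; rewrite /preimage/= ax.
Qed.

End Regular.

Theorem theorem12p1 (d : Order.disp_t) (L : orderType d)
    (L_wo : well_ordered L) (L_card : whole_is_cardinal L)
    (kappa : L) (kappa_reg : is_regular kappa)
    (kappa_unc : ~ countable (seg kappa))
    (alpha : L) (alpha_ge3 : at_least_three alpha)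
    (alpha_le : (alpha <= kappa)%O)
    (H : set (set (set L))) (H_ideal : ideal_on_Pk kappa H)
    (C : set (set (set L))) (C_cof : is_cof H C)
    (N : set (set L)) (N_non : is_non kappa alpha N)
    (C_lt_N : card_lt C N) :
  arrow_kk kappa H alpha.
Proof.
apply: arrow_kk_of_arrow => // A A_pos; apply: contrapT => narr.
have [[X Xgen CX] _] := C_cof.
have [Y Ygen YX] := projected_ideal_generates L_wo kappa_reg H_ideal A_pos Xgen.
(* A generating family [M] of least cardinality represents the cofinality of the projected ideal. If
   the relation failed there, then [N] would be at most [M], hence at most [Y], [X] and [C] in
   cardinality. *)
have [M Mgen Mmin] : exists2 M, generates (projected_ideal kappa H A) M &
    forall M', generates (projected_ideal kappa H A) M' -> M #<= M'.
  by apply: exists_card_min; exists Y.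
case: C_lt_N => _; apply; rewrite (card_le_eqr CX).
apply: card_le_trans YX; apply: card_le_trans (Mmin _ Ygen).
case: N_non => _ /(_ (projected_ideal kappa H A) M); apply=> //.
  exact: projected_ideal_on_kappa.
by split=> //; exists M.
Qed.
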